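(* A vector in $\mathbb{Z}^3$ is contained in a $3$-dimensional icube in $\mathbb{Z}^3$ if and only if its Euclidean length is an integer.
   Context: A $3$-dimensional icube in $\mathbb{Z}^3$ is a triple $(u,v,w)$ of nonzero vectors in $\mathbb{Z}^3$ that are pairwise orthogonal and have the same Euclidean length. A vector is contained in the icube if it is one of $u,v,w$. Vectors are nonzero. *)

(* Defs.v *)
From mathcomp Require Import all_boot all_order all_algebra.
From mathcomp Require Import reals.

Set Implicit Arguments.
Unset Strict Implicit.
Unset Printing Implicit Defensive.

Import Order.TTheory GRing.Theory Num.Theory.
Local Open Scope ring_scope.

Definition dotz (n : nat) (u v : 'rV[int]_n) : int :=
  \sum_(i < n) u 0 i * v 0 i.

Definition elength (R : realType) (n : nat) (u : 'rV[int]_n) : R :=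
  Num.sqrt (dotz u u)%:~R.
Arguments elength R {n} u.

Definition icube3 (R : realType) (u v w : 'rV[int]_3) : Prop :=
  [/\ [/\ u != 0, v != 0 & w != 0],
      [/\ dotz u v = 0, dotz u w = 0 & dotz v w = 0] &
      elength R u = elength R v /\ elength R v = elength R w].

Definition contained_in_icube3 (R : realType) (x : 'rV[int]_3) : Prop :=
  exists u v w : 'rV[int]_3, icube3 R u v w /\ [\/ x = u, x = v | x = w].

(* Main.v *)
Require Import Defs.
From mathcomp Require Import all_boot all_order all_algebra.
From mathcomp Require Import reals.
From mathcomp Require Import zify ring.

Import Order.TTheory GRing.Theory Num.Theory.
Local Open Scope ring_scope.

(** If [u, v, w] form an icube of squared length [N], the matrix with these
    rows has squared determinant [N ^ 3], so [N] is a square.  Conversely, let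
    [a^2 + b^2 + c^2 = d^2].  The Hermitian matrix with diagonal [d + a], [d - a]
    and off-diagonal entry [b + i c] has determinant zero, and reduction by
    elementary operations over the Gaussian integers writes its entries as
    [d + a = k |s|^2], [d - a = k |t|^2] and [b + i c = k s conj(t)] with [k] an
    integer and [s, t] Gaussian integers.  The real and imaginary parts of
    [k (- s t, (s^2 - t^2) / 2, - i (s^2 + t^2) / 2)] complete [(a, b, c)] to an
    icube; they are integral because [k (|s|^2 + |t|^2) = 2 d] is even. *)

(** The quotient is [b / p] rounded to a nearest integer, that is, the floor of
    [(2 b + p) / (2 p)]. *)
Lemma balanced_division (b p : int) : 0 < p ->
  exists g r : int, b = p * g + r /\ 4 * r ^+ 2 <= p ^+ 2.
Proof.
move=> p_gt0; exists ((2 * b + p) %/ (2 * p))%Z.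
exists (b - p * ((2 * b + p) %/ (2 * p))%Z); split; first by ring.
set r := b - _; suff : - p <= 2 * r <= p by move: r => r; clear; nia.
rewrite {}/r.
have := divz_eq (2 * b + p) (2 * p).
have := @modz_ge0 (2 * b + p) (2 * p) ltac:(lia).
have := @ltz_pmod (2 * b + p) (2 * p) ltac:(lia).
by move: (_ %/ _)%Z (_ %% _)%Z => g r; nia.
Qed.

(** Descent on the trace [p + q]: dividing [b + i c] by the smaller diagonal entry, with Gaussian
    quotient [g + i h], shrinks the other entry and keeps the determinant zero. *)
Lemma hermitian_rank1 (p q b c : int) : 0 <= p -> 0 <= q ->
  p * q = b ^+ 2 + c ^+ 2 ->
  exists k s1 s2 t1 t2 : int,
    [/\ p = k * (s1 ^+ 2 + s2 ^+ 2), q = k * (t1 ^+ 2 + t2 ^+ 2),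
        b = k * (s1 * t1 + s2 * t2) & c = k * (s2 * t1 - s1 * t2)].
Proof.
have [n] := ubnP `|(p + q)%R|%N; elim: n p q b c => // n IHn p q b c.
(* Exchanging [p] and [q] conjugates [b + i c] and exchanges [s] and [t]. *)
wlog le_pq : p q c / p <= q => [hwlog|] lt_n p_ge0 q_ge0 pq.
  have [/hwlog|/ltW le_qp] := leP p q; first exact.
  have [||||k [s1 [s2 [t1 [t2 [-> -> -> Ec]]]]]] := hwlog q p (- c) le_qp => //.
  - by rewrite addrC.
  - by rewrite mulrC pq sqrrN.
  by exists k, t1, t2, s1, s2; split=> //; lia.
have [p0|p_neq0] := eqVneq p 0.
  have [-> ->] : b = 0 /\ c = 0 by split; nia.
  by exists q, 0, 0, 1, 0; rewrite p0; split; ring.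
have p_gt0 : 0 < p by lia.
have [g [b' [Eb b'_small]]] := balanced_division b _ p_gt0.
have [h [c' [Ec c'_small]]] := balanced_division c _ p_gt0.
(* The second diagonal entry after the congruence that clears [p * (g + i h)] from the off-diagonal
   entry. *)
pose q' := q - 2 * (g * b' + h * c') - p * (g ^+ 2 + h ^+ 2).
have pq' : p * q' = b' ^+ 2 + c' ^+ 2.
  by rewrite /q' !mulrBr pq Eb Ec; ring.
have q'_ge0 : 0 <= q' by rewrite -(pmulr_rge0 _ p_gt0) pq' addr_ge0 ?sqr_ge0.
(* The two remainder bounds give [b' ^+ 2 + c' ^+ 2 <= p ^+ 2 / 2]. As [p <= q], the trace drops
   strictly. *)
have q'_lt : q' < p by rewrite -(ltr_pM2l p_gt0) pq' -expr2; clear -b'_small c'_small p_gt0; nia.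
have [|//|//||k [s1 [s2 [t1 [t2 [Ep Eq' Eb' Ec']]]]]] := IHn p q' b' c' => //.
  by lia.
have Eq : q = q' + 2 * (g * b' + h * c') + p * (g ^+ 2 + h ^+ 2).
  by rewrite /q'; ring.
(* t = t' + conj(g + i h) s *)
exists k, s1, s2, (t1 + g * s1 + h * s2), (t2 + g * s2 - h * s1).
by split=> //; rewrite ?Eq ?Eb ?Ec ?Eq' ?Eb' ?Ec' ?Ep; ring.
Qed.

Definition vec3 (a b c : int) : 'rV[int]_3 :=
  \row_i (if i == 0 then a else if i == 1 then b else c).

Lemma vec3_eta (x : 'rV[int]_3) : x = vec3 (x 0 0) (x 0 1) (x 0 2%:R).
Proof.
apply/rowP => i; rewrite mxE.
by case: i => [[|[|[|//]]] ?] /=; congr (x _ _); apply/val_inj.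
Qed.

Lemma dotz_vec3 (a b c a' b' c' : int) :
  dotz (vec3 a b c) (vec3 a' b' c') = a * a' + b * b' + c * c'.
Proof. by rewrite /dotz !big_ord_recl big_ord0 !mxE /= addr0 addrA. Qed.

Lemma dotz_ge0 (n : nat) (u : 'rV[int]_n) : 0 <= dotz u u.
Proof. by apply: sumr_ge0 => i _; rewrite -expr2 sqr_ge0. Qed.

Lemma dotz_eq0 (n : nat) (u : 'rV[int]_n) : (dotz u u == 0) = (u == 0).
Proof.
apply/eqP/eqP => [/eqP|->]; last first.
  by rewrite /dotz big1 // => i _; rewrite mxE mul0r.
rewrite psumr_eq0 => [|i _]; last by rewrite -expr2 sqr_ge0.
move=> /allP u0; apply/rowP => i; rewrite mxE.
by apply/eqP; have := u0 i (mem_index_enum i); rewrite mulf_eq0 orbb.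
Qed.

Lemma dotzC (n : nat) (u v : 'rV[int]_n) : dotz u v = dotz v u.
Proof. by apply: eq_bigr => i _; rewrite mulrC. Qed.

Lemma elength_eq (R : realType) (n : nat) (u v : 'rV[int]_n) :
  (elength R u = elength R v) <-> (dotz u u = dotz v v).
Proof.
rewrite /elength; split=> [/eqP|-> //].
by rewrite eqr_sqrt ?ler0z ?dotz_ge0 // eqr_int => /eqP.
Qed.

Lemma elength_intP (R : realType) (n : nat) (u : 'rV[int]_n) :
  elength R u \is a Num.int <-> exists2 d : int, 0 <= d & dotz u u = d ^+ 2.
Proof.
rewrite /elength; split=> [/intrP[d Ed]|[d d_ge0 ->]]; last first.
  by rewrite rmorphXn /= sqrtr_sqr -intr_norm intr_int.
exists d; first by rewrite -(ler0z R) -Ed sqrtr_ge0.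
apply/eqP; rewrite -(eqr_int R) rmorphXn /= -Ed sqr_sqrtr //.
by rewrite ler0z dotz_ge0.
Qed.

(** Since [N ^+ 2] divides [D ^+ 2], [N] divides [D], and the root is the absolute value of
    [D / N]. *)
Lemma square_of_cube_square (N D : int) :
  0 < N -> N ^+ 3 = D ^+ 2 -> exists2 m : int, 0 <= m & N = m ^+ 2.
Proof.
move=> N_gt0 ND.
have : (N ^+ 2 %| D ^+ 2)%Z by rewrite -ND exprS dvdz_mull.
rewrite dvdzE !abszX dvdn_pexp2r // => N_dvd_D.
have /dvdzP[m Dm] : (N %| D)%Z by [].
have N2_neq0 : N ^+ 2 != 0 by rewrite expf_neq0 // gt_eqF.
exists `|m|; rewrite // real_normK ?num_real //.
by apply: (mulIf N2_neq0); rewrite -exprS ND Dm exprMn.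
Qed.

Lemma orthogonal_frame_square (u v w : 'rV[int]_3) (N : int) : 0 < N ->
  dotz u u = N -> dotz v v = N -> dotz w w = N ->
  dotz u v = 0 -> dotz u w = 0 -> dotz v w = 0 ->
  exists2 m : int, 0 <= m & N = m ^+ 2.
Proof.
move=> N_gt0 uu vv ww uv uw vw.
pose rows (i : 'I_3) := if i == 0 then u else if i == 1 then v else w.
pose A : 'M[int]_3 := \matrix_i rows i.
apply: (square_of_cube_square N (\det A)) => //.
(* Both sides become determinants, of the scalar matrix [N] and of the Gram matrix of the rows,
   which are then compared entrywise. *)
rewrite -det_scalar expr2 -{2}(det_tr A) -det_mulmx; congr (\det _).
apply/matrixP => i j; rewrite !mxE.
under eq_bigr do rewrite !mxE.
rewrite -/(dotz (rows i) (rows j)) /rows.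
by case: i j => [[|[|[|//]]] ?] [[|[|[|//]]] ?] //=; rewrite dotzC.
Qed.

(** The complex vector [v + i w] is isotropic for the bilinear dot product, because [(s t)^2 + ((s^2
    - t^2) / 2)^2 = ((s^2 + t^2) / 2)^2]; hence [v] and [w] are orthogonal of equal length. *)
Lemma square_norm_orthogonal_frame (a b c d : int) : 0 <= d ->
  a ^+ 2 + b ^+ 2 + c ^+ 2 = d ^+ 2 ->
  exists v w : 'rV[int]_3,
    [/\ dotz v v = d ^+ 2, dotz w w = d ^+ 2, dotz (vec3 a b c) v = 0,
        dotz (vec3 a b c) w = 0 & dotz v w = 0].
Proof.
move=> d_ge0 norm_d.
(* Both diagonal entries are nonnegative because [a ^+ 2 <= d ^+ 2]. *)
have [|||k [s1 [s2 [t1 [t2 [Ep Eq Eb Ec]]]]]] :=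
  @hermitian_rank1 (d + a) (d - a) b c; [by nia..| |].
  by rewrite mulrC -subr_sqr -norm_d; ring.
(* [e] and [f] are the real parts of [k (s^2 - t^2) / 2] and [k (s^2 + t^2) / 2], written without
   division. *)
pose e := a - k * s2 ^+ 2 + k * t2 ^+ 2.
pose f := d - k * s2 ^+ 2 - k * t2 ^+ 2.
have Ea2 : 2 * a = k * (s1 ^+ 2 + s2 ^+ 2 - t1 ^+ 2 - t2 ^+ 2).
  by transitivity ((d + a) - (d - a)); [|rewrite Ep Eq]; ring.
have Ed2 : 2 * d = k * (s1 ^+ 2 + s2 ^+ 2 + t1 ^+ 2 + t2 ^+ 2).
  by transitivity ((d + a) + (d - a)); [|rewrite Ep Eq]; ring.
have Ee2 : 2 * e = k * (s1 ^+ 2 - s2 ^+ 2 - t1 ^+ 2 + t2 ^+ 2).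
  by rewrite /e !mulrDr Ea2; ring.
have Ef2 : 2 * f = k * (s1 ^+ 2 - s2 ^+ 2 + t1 ^+ 2 - t2 ^+ 2).
  by rewrite /f !mulrDr Ed2; ring.
exists (vec3 (- (k * (s1 * t1 - s2 * t2))) e (k * (s1 * s2 + t1 * t2))).
exists (vec3 (- (k * (s1 * t2 + s2 * t1))) (k * (s1 * s2 - t1 * t2)) (- f)).
(* Only the doubled values of [e] and [f] are kept; multiplying each goal by 4 makes every half
   appear doubled, which leaves polynomial identities in [k], [s], [t]. *)
move: e f Ee2 Ef2 => e f Ee2 Ef2.
have cancel4 (y z : int) : (2 * 2) * y = (2 * 2) * z -> y = z by exact: mulfI.
rewrite !dotz_vec3 Eb Ec; split; apply: cancel4.
- transitivity ((2 * e) ^+ 2 + 4 * ((k * (s1 * t1 - s2 * t2)) ^+ 2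
    + (k * (s1 * s2 + t1 * t2)) ^+ 2)); first by ring.
  by transitivity ((2 * d) ^+ 2); [rewrite Ee2 Ed2|]; ring.
- transitivity ((2 * f) ^+ 2 + 4 * ((k * (s1 * t2 + s2 * t1)) ^+ 2
    + (k * (s1 * s2 - t1 * t2)) ^+ 2)); first by ring.
  by transitivity ((2 * d) ^+ 2); [rewrite Ef2 Ed2|]; ring.
- transitivity (2 * (- (2 * a) * (k * (s1 * t1 - s2 * t2))
    + k * (s1 * t1 + s2 * t2) * (2 * e)
    + 2 * (k * (s2 * t1 - s1 * t2) * (k * (s1 * s2 + t1 * t2))))).
    by ring.
  by rewrite Ea2 Ee2; ring.
- transitivity (2 * (- (2 * a) * (k * (s1 * t2 + s2 * t1))
    + 2 * (k * (s1 * t1 + s2 * t2) * (k * (s1 * s2 - t1 * t2)))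
    - k * (s2 * t1 - s1 * t2) * (2 * f))).
    by ring.
  by rewrite Ea2 Ef2; ring.
- transitivity (2 * (2 * (k * (s1 * t1 - s2 * t2) * (k * (s1 * t2 + s2 * t1)))
    + (2 * e) * (k * (s1 * s2 - t1 * t2))
    - k * (s1 * s2 + t1 * t2) * (2 * f))).
    by ring.
  by rewrite Ee2 Ef2; ring.
Qed.

Theorem theorem1p4 (R : realType) (x : 'rV[int]_3) (hx : x != 0) :
  contained_in_icube3 R x <-> elength R x \is a Num.int.
Proof.
split=> [[u [v [w [[[u0 _ _] [uv uw vw] [Euv Evw]] x_in]]]]|].
  have -> : elength R x = elength R u by case: x_in => ->; rewrite ?Euv ?Evw.
  apply/elength_intP; move/elength_eq: Euv => Euv; move/elength_eq: Evw => Evw.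
  apply: (orthogonal_frame_square u v w) => //.
  - by rewrite lt_def dotz_eq0 u0 dotz_ge0.
  - by rewrite -Evw.
move=> /elength_intP[d d_ge0 xx].
have [|v [w [vv ww]]] :=
  @square_norm_orthogonal_frame (x 0 0) (x 0 1) (x 0 2%:R) d d_ge0.
  by rewrite -xx [in RHS](vec3_eta x) dotz_vec3 !expr2.
rewrite -vec3_eta => xv xw vw.
(* This also makes [v] and [w] nonzero, as their squared length is [d ^+ 2]. *)
have d2_neq0 : d ^+ 2 != 0 by rewrite -xx dotz_eq0.
exists x, v, w; split; last by constructor 1.
split; first by split; rewrite // -dotz_eq0 ?vv ?ww.
  by [].
by split; apply/elength_eq; rewrite ?xx ?vv ?ww.
Qed.
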